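(* Let $M\ge2$ be an integer, let $\Sigma_D$ be the Dyck shift on $M$ pairs of brackets with left shift $\sigma$, and let $f\colon\Sigma_D\to\mathbb R$ be given by $f(x)=0$ if $x_0\in D_\alpha$ and $f(x)=1$ if $x_0\in D_\beta$. The rate function $I_f\colon\mathbb R\to[0,\infty]$ of the LDP for the sequence of probability measures $\big(\#\{x\in{\rm Per}_{n}(\sigma)\colon (1/n)S_nf(x)\in \cdot\}/\#{\rm Per}_{n}(\sigma)\big)_{n=1}^\infty$ on $\mathbb R$ is given by \[I_f(t)=\begin{cases}t\log t+(1-t)\log(1-t)+\log((M+1)/M^{1-t}) & \text{if }t\in[0,1/2],\\ t\log t+(1-t)\log(1-t)+\log((M+1)/M^t) &\text{if }t\in(1/2, 1],\\ \infty & \text{if }t\in\mathbb R\setminus[0,1].\end{cases}\] This rate function is non-convex, and it is not differentiable at $t=1/2$.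
   Context: Convention: $0\log0=0$. Dyck shift: Let $M\ge2$ be an integer, $D_\alpha=\{\alpha_1,\ldots,\alpha_M\}$ and $D_\beta=\{\beta_1,\ldots,\beta_M\}$ disjoint alphabets of $M$ symbols each, $D=D_\alpha\cup D_\beta$. Consider the monoid with zero $0$ and unit $1$ generated by $D$ with relations $\alpha_i\cdot\beta_j=\delta_{ij}$ (that is, $1$ if $i=j$ and $0$ if $i\ne j$), $0\cdot0=0$, $\gamma\cdot1=1\cdot\gamma=\gamma$, $\gamma\cdot0=0\cdot\gamma=0$. For a finite word $\gamma_1\cdots\gamma_n$ in $D$ let ${\rm red}(\gamma_1\cdots\gamma_n)=\prod_{i=1}^n\gamma_i$. The Dyck shift is $\Sigma_D=\{x\in D^{\mathbb Z}\colon {\rm red}(x_j\cdots x_k)\ne0\text{ for all }j<k\}$, with left shift $\sigma$, and ${\rm Per}_n(\sigma)=\{x\in\Sigma_D\colon\sigma^nx=x\}$. $S_nf(x)=\sum_{i=0}^{n-1}f(\sigma^ix)$. Large Deviation Principle (LDP): a sequence $(\mu_n)$ of Borel probability measures on a topological space $\mathcal X$ satisfies the LDP with rate function $J$ if $J\colon\mathcal X\to[0,\infty]$ is lower semicontinuous, $\liminf_n\frac1n\log\mu_n(\mathcal G)\ge-\inf_{\mathcal G}J$ for every open $\mathcal G\subset\mathcal X$ and $\limsup_n\frac1n\log\mu_n(\mathcal C)\le-\inf_{\mathcal C}J$ for every closed $\mathcal C\subset\mathcal X$. The rate function is unique when $\mathcal X$ is metrizable. *)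

(* Defs.v *)
From HB Require Import structures.
From mathcomp Require Import all_boot all_order all_algebra finmap.
From mathcomp Require Import all_classical all_reals all_analysis.

Set Implicit Arguments.
Unset Strict Implicit.
Unset Printing Implicit Defensive.

Import Order.TTheory GRing.Theory Num.Theory.
Import numFieldNormedType.Exports.

Local Open Scope classical_set_scope.
Local Open Scope ring_scope.
Local Open Scope quotient_scope.

(* [inl i] is the opening bracket alpha_i, [inr i] the closing bracket beta_i. *)
Notation dyck_alphabet M := ('I_M + 'I_M)%type.

(* The free monoid with zero on D: [Some w] is the word [w], [None] is 0, so
   that 0 is absorbing and the empty word is a unit by construction. *)
Definition dyck_free (M : nat) := option (seq (dyck_alphabet M)).

Definition dyck_free_mul (M : nat) (u v : dyck_free M) : dyck_free M :=
  match u, v with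
  | Some s, Some t => Some (s ++ t)
  | _, _ => None
  end.

(* The congruence generated by alpha_i beta_j = delta_{ij}. *)
Inductive dyck_cong (M : nat) : dyck_free M -> dyck_free M -> Prop :=
| dyck_cong_rel i j :
    dyck_cong (Some [:: inl i; inr j]) (if i == j then Some [::] else None)
| dyck_cong_mul u u' v v' : dyck_cong u u' -> dyck_cong v v' ->
    dyck_cong (dyck_free_mul u v) (dyck_free_mul u' v')
| dyck_cong_refl u : dyck_cong u u
| dyck_cong_sym u v : dyck_cong u v -> dyck_cong v u
| dyck_cong_trans v u w : dyck_cong u v -> dyck_cong v w -> dyck_cong u w.

Definition dyck_congb (M : nat) : rel (dyck_free M) :=
  fun u v => `[< dyck_cong u v >].

Lemma dyck_congb_refl (M : nat) : reflexive (@dyck_congb M).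
Proof. by move=> u; apply/asboolP; exact: dyck_cong_refl. Qed.

Lemma dyck_congb_sym (M : nat) : symmetric (@dyck_congb M).
Proof. by move=> u v; apply/asboolP/asboolP; exact: dyck_cong_sym. Qed.

Lemma dyck_congb_trans (M : nat) : transitive (@dyck_congb M).
Proof.
move=> v u w /asboolP uv /asboolP vw.
by apply/asboolP; exact: dyck_cong_trans uv vw.
Qed.

Canonical dyck_congb_equiv (M : nat) := EquivRel (@dyck_congb M)
  (@dyck_congb_refl M) (@dyck_congb_sym M) (@dyck_congb_trans M).

Definition dyck_monoid (M : nat) := {eq_quot (@dyck_congb M)}.

HB.instance Definition _ (M : nat) := Choice.on (dyck_monoid M).
HB.instance Definition _ (M : nat) := EqQuotient.on (dyck_monoid M).

Definition dyck_class (M : nat) (u : dyck_free M) : dyck_monoid M :=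
  \pi_(dyck_monoid M) u.

Definition dyck_zero (M : nat) : dyck_monoid M := dyck_class None.

Definition dyck_one (M : nat) : dyck_monoid M := dyck_class (Some [::]).

Definition dyck_mul (M : nat) (u v : dyck_monoid M) : dyck_monoid M :=
  dyck_class (dyck_free_mul (repr u) (repr v)).

Lemma dyck_classE (M : nat) (a b : dyck_free M) :
  dyck_class a = dyck_class b <-> dyck_cong a b.
Proof. by split=> [/eqmodP /asboolP //|ab]; apply/eqmodP/asboolP. Qed.

Lemma dyck_classW (M : nat) (P : dyck_monoid M -> Prop) :
  (forall a, P (dyck_class a)) -> forall u, P u.
Proof. by move=> Pc; elim/quotW. Qed.

Lemma dyck_mulE (M : nat) (a b : dyck_free M) :
  dyck_mul (dyck_class a) (dyck_class b) = dyck_class (dyck_free_mul a b).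
Proof.
by apply/dyck_classE; apply: dyck_cong_mul; apply/dyck_classE;
  rewrite /dyck_class reprK.
Qed.

Lemma dyck_mulA (M : nat) : associative (@dyck_mul M).
Proof.
elim/dyck_classW => a; elim/dyck_classW => b; elim/dyck_classW => c.
rewrite !dyck_mulE; congr dyck_class.
by case: a b c => [a|] [b|] [c|] //=; rewrite catA.
Qed.

Lemma dyck_mul1g (M : nat) : left_id (dyck_one M) (@dyck_mul M).
Proof. by elim/dyck_classW => a; rewrite dyck_mulE; case: a. Qed.

Lemma dyck_mulg1 (M : nat) : right_id (dyck_one M) (@dyck_mul M).
Proof.
by elim/dyck_classW => a; rewrite dyck_mulE; case: a => //= a; rewrite cats0.
Qed.

HB.instance Definition _ (M : nat) := isMonoid.Build (dyck_monoid M)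
  (@dyck_mulA M) (@dyck_mul1g M) (@dyck_mulg1 M).

Definition dyck_gen (M : nat) (c : dyck_alphabet M) : dyck_monoid M :=
  dyck_class (Some [:: c]).

Definition red (M : nat) (w : seq (dyck_alphabet M)) : dyck_monoid M :=
  (\big[*%g/1%g]_(c <- w) dyck_gen c)%g.

(* The word x_j ... x_k, for j <= k. *)
Definition subword (A : Type) (x : int -> A) (j k : int) : seq A :=
  [seq x (j + i%:Z) | i <- iota 0 `|k - j|%N.+1].

Definition dyck_shift (M : nat) : set (int -> dyck_alphabet M) :=
  [set x | forall j k : int, j < k -> red (subword x j k) <> dyck_zero M].
Arguments dyck_shift : clear implicits.

Definition shift (A : Type) (x : int -> A) : int -> A := fun i => x (i + 1).

Definition dyck_per (M n : nat) : set (int -> dyck_alphabet M) :=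
  [set x | dyck_shift M x /\ iter n (@shift _) x = x].
Arguments dyck_per : clear implicits.

(* The observable and its Birkhoff sums are defined on the whole full shift;
   only their values on the Dyck shift matter. *)
Definition dyck_obs (R : realType) (M : nat) (x : int -> dyck_alphabet M) : R :=
  if x 0 is inl _ then 0 else 1.
Arguments dyck_obs : clear implicits.

Definition birkhoff_sum (R : realType) (A : Type) (f : (int -> A) -> R) (n : nat)
    (x : int -> A) : R :=
  \sum_(0 <= i < n) f (iter i (@shift _) x).

(* The law of [F] under the uniform distribution on the finite set [A]. *)
Definition uniform_law (R : realType) d (T : measurableType d) (U : choiceType)
    (A : set U) (F : U -> T) (finA : finite_set A) (A0 : A !=set0) (B : set T)
    : \bar R :=
  (#|` fset_set [set x | A x /\ B (F x)] |%:R / #|` fset_set A |%:R)%:E.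

Section UniformLawTheory.
Context (R : realType) (d : measure_display) (T : measurableType d).
Context (U : choiceType) (A : set U) (F : U -> T).
Context (finA : finite_set A) (A0 : A !=set0).
Local Notation P := (uniform_law R F finA A0).
Local Open Scope ereal_scope.

Lemma card_fset_set_gt0 : (0 < #|` fset_set A |)%N.
Proof.
have [a Aa] := A0; rewrite cardfs_gt0; apply/fset0Pn; exists a.
by rewrite in_fset_set// inE.
Qed.

Lemma uniform_lawE (a : U) (B : set T) : P B =
  ((#|` fset_set A |%:R : R)^-1)%:E *
  \sum_(k < #|` fset_set A |) \d_(F (nth a (fset_set A) k)) B.
Proof.
rewrite /uniform_law mulrC EFinM; congr (_ * _).
have -> : fset_set [set x | A x /\ B (F x)] =
    [fset x in fset_set A | F x \in B]%fset.
  apply/fsetP => x; rewrite !inE in_fset_set; last first.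
    by apply: sub_finite_set finA => y [].
  rewrite in_fset_set//; apply/idP/andP.
    by rewrite inE => -[Ax BFx]; rewrite !inE.
  by rewrite !inE => -[].
rewrite -(big_mkord xpredT (fun k => \d_(F (nth a (fset_set A) k)) B)).
rewrite -(big_nth a xpredT (fun x => \d_(F x) B)).
rewrite card_imfset//= -sum1_size big_filter.
rewrite natr_sum -sumEFin big_mkcond/=.
by apply: eq_bigr => x _; rewrite diracE; case: ifP.
Qed.

Let uniform_law0 : P set0 = 0.
Proof.
have [a _] := A0; rewrite (uniform_lawE a) big1 ?mule0//.
Qed.

Let uniform_law_ge0 (B : set T) : 0 <= P B.
Proof. by rewrite lee_fin divr_ge0. Qed.

Let uniform_law_sigma_additive : semi_sigma_additive P.
Proof.
have [a _] := A0.
have r0 : (0 <= (#|` fset_set A |%:R : R)^-1)%R by rewrite invr_ge0.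
have -> : P = mscale (NngNum r0) (msum
    (fun k => \d_(F (nth a (fset_set A) k)) : {measure set T -> \bar R})
    #|` fset_set A |).
  by apply/funext => B; rewrite (uniform_lawE a).
exact: measure_semi_sigma_additive.
Qed.

HB.instance Definition _ := isMeasure.Build _ _ _ P
  uniform_law0 uniform_law_ge0 uniform_law_sigma_additive.

Let uniform_lawT : P setT = 1.
Proof.
rewrite /uniform_law (_ : [set x | _] = A); last first.
  by apply/seteqP; split=> [x []|].
by rewrite divff// pnatr_eq0 -lt0n card_fset_set_gt0.
Qed.

HB.instance Definition _ := Measure_isProbability.Build _ _ _ P uniform_lawT.

End UniformLawTheory.

(* The action of words on stacks of bracket indices, read from right to left:
   beta_j pushes j, alpha_i pops i and is undefined if the top is not i. *)
Definition dyck_step (M : nat) (c : dyck_alphabet M) (s : option (seq 'I_M)) :=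
  match c, s with
  | inr j, Some t => Some (j :: t)
  | inl i, Some (j :: t) => if i == j then Some t else None
  | _, _ => None
  end.

Definition dyck_act (M : nat) (u : dyck_free M) (s : option (seq 'I_M)) :=
  if u is Some w then foldr (@dyck_step M) s w else None.

Lemma dyck_act_mul (M : nat) (u v : dyck_free M) s :
  dyck_act (dyck_free_mul u v) s = dyck_act u (dyck_act v s).
Proof.
case: u v => [u|] [v|] //=; first by rewrite foldr_cat.
by elim: u => //= c u <-; case: c.
Qed.

Lemma dyck_act_cong (M : nat) (u v : dyck_free M) :
  dyck_cong u v -> dyck_act u =1 dyck_act v.
Proof.
elim=> {u v} [i j s|u u' v v' _ IHu _ IHv s|//|u v _ IH s|v u w _ IH _ IH' s].
- by case: s => [s|] /=; case: (i == j).
- by rewrite !dyck_act_mul IHu IHv.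
- by rewrite IH.
- by rewrite IH IH'.
Qed.

Lemma redE (M : nat) (w : seq (dyck_alphabet M)) : red w = dyck_class (Some w).
Proof.
rewrite /red; elim: w => [|c w IH]; first by rewrite big_nil.
by rewrite big_cons IH; exact: dyck_mulE.
Qed.

Lemma iter_shiftE (A : Type) (n : nat) (x : int -> A) (i : int) :
  iter n (@shift A) x i = x (i + n%:Z).
Proof.
elim: n i => [|n IH] i /=; first by rewrite addr0.
by rewrite /shift IH -addrA -PoszD add1n.
Qed.

Lemma dyck_per_neq0 (M n : nat) : (0 < M)%N -> dyck_per M n !=set0.
Proof.
move=> M0; pose i0 := Ordinal M0; exists (fun=> inl i0); split; last first.
  by elim: n => //= n ->.
move=> j k _; rewrite redE /subword => /dyck_classE /dyck_act_cong.
set w := iota _ _ => /(_ (Some (nseq (size w) i0 ++ [::]))); rewrite /dyck_act.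
suff pops (s : seq nat) t : foldr (@dyck_step M) (Some (nseq (size s) i0 ++ t))
  [seq inl i0 | _ <- s] = Some t by rewrite pops.
elim: s t => //= _ s IH t.
suff -> : i0 :: nseq (size s) i0 ++ t = nseq (size s) i0 ++ i0 :: t.
  by rewrite IH eqxx.
by elim: (size s) => //= m ->.
Qed.

Lemma dyck_per_finite (M n : nat) : (0 < n)%N -> finite_set (dyck_per M n).
Proof.
case: n => // n _.
pose g (w : {ffun 'I_n.+1 -> dyck_alphabet M}) (i : int) :=
  w (inord `|(i %% n.+1%:Z)%Z|%N).
apply: (@sub_finite_set _ _ (g @` setT)); last first.
  by apply: finite_image; exact: finite_finset.
move=> x [_ xn]; exists [ffun i : 'I_n.+1 => x (val i)%:Z] => //.
have xnat (q : nat) i : x (i + (q * n.+1)%N%:Z) = x i.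
  elim: q i => [|q IH] i; first by rewrite mul0n addr0.
  by rewrite mulSn PoszD addrA IH -iter_shiftE xn.
have xint (q i : int) : x (i + q * n.+1%:Z) = x i.
  case: q => q; first by rewrite -PoszM xnat.
  by rewrite -(xnat q.+1 (i + _)) NegzE mulNr -PoszM subrK.
apply/funext => i; rewrite /g ffunE /= inordK; last first.
  by rewrite -ltz_nat gez0_abs ?modz_ge0// ltz_pmod.
by rewrite gez0_abs ?modz_ge0// -(xint (i %/ n.+1%:Z)%Z) addrC -divz_eq.
Qed.

Definition borel (X : ptopologicalType) := g_sigma_algebraType (@open X).

(* The sequence of measures is indexed from 1: [mu n] is the measure of index
   [n.+1], whence the speed [n.+1]. *)
Definition LDP (R : realType) (X : ptopologicalType)
    (mu : nat -> probability (borel X) R) (J : X -> \bar R) : Prop :=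
  [/\ forall x, (0 <= J x)%E,
      lower_semicontinuous J,
      forall G : set X, open G ->
        (- ereal_inf (J @` G) <=
         limn_einf (fun n => (n.+1%:R^-1)%:E * lne (mu n G)))%E
    & forall C : set X, closed C ->
        (limn_esup (fun n => (n.+1%:R^-1)%:E * lne (mu n C)) <=
         - ereal_inf (J @` C))%E].

(* The law of (1/n) S_n f under the uniform distribution on Per_n(sigma),
   for n = m + 1. *)
Definition dyck_law (R : realType) (M : nat) (M2 : (2 <= M)%N) (m : nat) :
    probability (borel R) R :=
  uniform_law R
    (fun x => m.+1%:R^-1 * birkhoff_sum (dyck_obs R M) m.+1 x : borel R)
    (@dyck_per_finite M m.+1 isT) (@dyck_per_neq0 M m.+1 (ltnW M2)).

(* Since [ln 0 = 0], the convention 0 log 0 = 0 holds. *)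
Definition dyck_rate (R : realType) (M : nat) (t : R) : \bar R :=
  if (0 <= t <= 2^-1) then
    (t * ln t + (1 - t) * ln (1 - t) + ln (M.+1%:R / M%:R `^ (1 - t)))%:E
  else if (2^-1 < t <= 1) then
    (t * ln t + (1 - t) * ln (1 - t) + ln (M.+1%:R / M%:R `^ t))%:E
  else +oo%E.
Arguments dyck_rate : clear implicits.

Definition ereal_convex (R : realType) (J : R -> \bar R) : Prop :=
  forall (x y l : R), 0 <= l <= 1 ->
    (J (l * x + (1 - l) * y)%R <= l%:E * J x + (1 - l)%:E * J y)%E.

(* Main.v *)
(* In a periodic point of period n with at most n/2 closing brackets per period,
   every closing bracket is matched with an opening one less than n places to its
   left. The position of the match depends only on the pattern of openings and
   closings, and the two labels agree. Hence the labels of the openings are free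
   and determine those of the closings. Reversing and exchanging brackets handles
   the other case, so exactly C(n, b) M^max(b, n - b) points of period n have b
   closings per period.
   By the entropy estimate n H(b/n) - ln (n + 1) <= ln C(n, b) <= n H(b/n), the
   mass of b/n is exp (- n I(b/n)) up to a factor polynomial in n, where I extends
   to a continuous function on the real line; this gives both large deviation
   bounds. *)
Require Import Defs.
From mathcomp Require Import all_boot all_order all_algebra finmap zify ring lra.
From mathcomp Require Import all_classical all_reals all_analysis.
Import Order.TTheory GRing.Theory Num.Theory.
Import numFieldNormedType.Exports.
Local Open Scope ring_scope.

Set Implicit Arguments.
Unset Strict Implicit.
Unset Printing Implicit Defensive.

(** * The Dyck shift through stacks *)

Lemma dyck_cong_cons (M : nat) (c : dyck_alphabet M) (w : seq (dyck_alphabet M))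
    (u : dyck_free M) :
  dyck_cong (Some w) u ->
  dyck_cong (Some (c :: w)) (dyck_free_mul (Some [:: c]) u).
Proof.
by move=> wu; apply: (dyck_cong_mul (u := Some [:: c]) (v := Some w)) => //;
  exact: dyck_cong_refl.
Qed.

(** An opening prepended to a normal form that starts with a closing either cancels that closing or
    yields 0; every other prepended letter keeps the form. *)
Lemma dyck_normal_form (M : nat) (w : seq (dyck_alphabet M)) :
  dyck_cong (Some w) None \/
  exists B A : seq 'I_M, dyck_cong (Some w) (Some (map inr B ++ map inl A)).
Proof.
elim: w => [|c w [IH|[B [A IH]]]].
- by right; exists [::], [::]; exact: dyck_cong_refl.
- by left; exact: (dyck_cong_cons c IH).
case: c => [i|j]; last first.
  by right; exists (j :: B), A; exact: (dyck_cong_cons (inr j) IH).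
case: B IH => [|j B] IH.
  by right; exists [::], (i :: A); exact: (dyck_cong_cons (inl i) IH).
have := dyck_cong_cons (inl i) IH.
have := dyck_cong_mul (dyck_cong_rel i j)
  (dyck_cong_refl (Some (map inr B ++ map inl A))).
case: eqP => _ /= red_ij ij.
- by right; exists B, A; exact: dyck_cong_trans ij red_ij.
- by left; exact: dyck_cong_trans ij red_ij.
Qed.

(** The stack action is invariant under the congruence, so a surviving stack excludes 0. Conversely,
    in a normal form only the openings can fail, and [rev A] is exactly the stack that they pop. *)
Lemma red_neq0P (M : nat) (w : seq (dyck_alphabet M)) :
  red w <> dyck_zero M <->
  exists s, foldr (@dyck_step M) (Some s) w != None.
Proof.
split=> [w0|[s ws]]; last first.
  rewrite redE => /dyck_classE /dyck_act_cong /(_ (Some s)) /= wN.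
  by rewrite wN eqxx in ws.
have [wN|[B [A wBA]]] := dyck_normal_form w.
  by exfalso; apply: w0; rewrite redE; apply/dyck_classE.
exists (rev A); have := dyck_act_cong wBA (Some (rev A)) => /= ->.
rewrite foldr_cat.
have -> : foldr (@dyck_step M) (Some (rev A)) (map inl A) = Some [::].
  rewrite -{1}(cats0 (rev A)); elim: A {wBA} [::] => //= i A IH t.
  by rewrite rev_cons cat_rcons IH eqxx.
by elim: B {wBA} [::] => [|j B IH] t //=; case: foldr (IH t).
Qed.

(* [past x j k] is the word x_{j-k+1} ... x_j. *)
Fixpoint past (T : Type) (x : int -> T) (j : int) (k : nat) : seq T :=
  if k is k'.+1 then x (j - k'%:Z) :: past x j k' else [::].

Lemma map_iota_past (T : Type) (x : int -> T) (j : int) (m k : nat) :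
  [seq x (j + i%:Z) | i <- iota m k] = past x (j + m%:Z + k%:Z - 1) k.
Proof.
elim: k m => [|k IH] m //=; rewrite IH; congr cons; first by congr x; lia.
by congr past; lia.
Qed.

Lemma rev_past (T : Type) (x : int -> T) (j : int) (m k : nat) :
  rev (past x (j - m%:Z) k) = [seq x (j - i%:Z) | i <- iota m k].
Proof.
have past_rcons i l : past x i l.+1 = rcons (past x (i - 1) l) (x i).
  elim: l => [|l IH]; first by rewrite /= subr0.
  rewrite [LHS]/= -/(past x i l.+1) IH /=; congr cons; first by congr x; lia.
elim: k m => [|k IH] m //; rewrite past_rcons rev_rcons /= -IH.
by congr (_ :: rev (past _ _ _)); lia.
Qed.

Lemma subword_past (T : Type) (x : int -> T) (j k : int) : j < k ->
  subword x j k = past x k `|k - j|%N.+1.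
Proof. by move=> jk; rewrite /subword map_iota_past; congr past; lia. Qed.

Lemma dyck_shiftP (M : nat) (x : int -> dyck_alphabet M) :
  dyck_shift M x <->
  forall j k, exists s, foldr (@dyck_step M) (Some s) (past x j k) != None.
Proof.
split=> [xD j k|xD j k jk]; last first.
  rewrite subword_past//; exact/red_neq0P/xD.
(* [dyck_shift] constrains only words of length at least 2; a single opening acts on the stack
   holding its label. *)
case: k => [|[|k]].
- by exists [::].
- rewrite /= ; case: (x (j - 0)) => [i|i]; last by exists [::].
  by exists [:: i]; rewrite /= eqxx.
have /red_neq0P := xD (j - k.+1%:Z) j (ltac:(lia) : j - k.+1%:Z < j).
rewrite subword_past; last by lia.
by have -> : `|(j - (j - k.+1%:Z))%R|%N.+1 = k.+2 by lia.
Qed.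

(** * Reversal symmetry *)

Definition dyck_flip (M : nat) (c : dyck_alphabet M) : dyck_alphabet M :=
  match c with inl i => inr i | inr i => inl i end.

Lemma dyck_flipK (M : nat) : involutive (@dyck_flip M).
Proof. by case. Qed.

Definition dyck_free_rev (M : nat) (u : dyck_free M) : dyck_free M :=
  omap (fun w => rev (map (@dyck_flip M) w)) u.

(** Reversing words and exchanging brackets is an anti-automorphism: the relation for alpha_i beta_j
    becomes the one for alpha_j beta_i. *)
Lemma dyck_cong_rev (M : nat) (u v : dyck_free M) :
  dyck_cong u v -> dyck_cong (dyck_free_rev u) (dyck_free_rev v).
Proof.
have revM (a b : dyck_free M) : dyck_free_rev (dyck_free_mul a b) =
    dyck_free_mul (dyck_free_rev b) (dyck_free_rev a).
  by case: a b => [a|] [b|] //=; rewrite map_cat rev_cat.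
elim=> {u v} [i j|u u' v v' _ IHu _ IHv|u|u v _ IH|v u w _ IHu _ IHv].
- rewrite /= /rev /=; have := dyck_cong_rel j i; rewrite eq_sym.
  by case: ifP.
- by rewrite !revM; exact: dyck_cong_mul.
- exact: dyck_cong_refl.
- exact: dyck_cong_sym.
- exact: dyck_cong_trans IHu IHv.
Qed.

Lemma dyck_shift_rev (M : nat) (x : int -> dyck_alphabet M) (c : int) :
  dyck_shift M x -> dyck_shift M (fun i => dyck_flip (x (c - i))).
Proof.
move=> xD j k jk; have := xD (c - k) (c - j) (ltac:(lia) : c - k < c - j).
rewrite !redE => x0 /dyck_classE/dyck_cong_rev y0; apply: x0.
apply/dyck_classE; move: y0.
rewrite [dyck_free_rev None]/= /dyck_free_rev [omap _ _]/omap /obind /oapp.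
congr dyck_cong; congr Some.
rewrite subword_past// -map_rev. rewrite -{1}(subr0 k) (rev_past _ k 0) /subword.
have -> : `|(c - j - (c - k))%R|%N = `|k - j|%N by lia.
rewrite -map_comp; apply: eq_map => i /=; rewrite dyck_flipK.
by congr x; lia.
Qed.

(** * Matched brackets *)

Definition closing (M : nat) (c : dyck_alphabet M) : bool :=
  if c is inr _ then true else false.

Definition label (M : nat) (c : dyck_alphabet M) : 'I_M :=
  match c with inl i | inr i => i end.

Arguments closing {M}.

(* Openings minus closings at the [k] positions [j-k+1], ..., [j]. *)
Fixpoint balance (P : int -> bool) (j : int) (k : nat) : int :=
  if k is k'.+1 then (if P (j - k'%:Z) then -1 else 1) + balance P j k' else 0.

Arguments balance : simpl never.

(* If [P j], this says that [j - k] is the opening matched with [j]. *)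
Definition first_return (P : int -> bool) (j : int) (k : nat) : Prop :=
  balance P j k.+1 = 0 /\ forall i, (i < k)%N -> balance P j i.+1 < 0.

Lemma balanceS (P : int -> bool) j k :
  balance P j k.+1 = (if P (j - k%:Z) then -1 else 1) + balance P j k.
Proof. by []. Qed.

Lemma balance1 (P : int -> bool) j : balance P j 1 = if P j then -1 else 1.
Proof. by rewrite balanceS addr0 subr0. Qed.

Lemma balance_bound (P : int -> bool) j k : `|balance P j k| <= k%:Z.
Proof. by elim: k => // k IH; rewrite balanceS; case: ifP => _; lia. Qed.

Lemma balanceD (P : int -> bool) j k m :
  balance P j (k + m) = balance P j k + balance P (j - k%:Z) m.
Proof.
elim: m => [|m IH]; first by rewrite addn0 addr0.
rewrite addnS !balanceS IH (_ : j - (k + m)%N%:Z = j - k%:Z - m%:Z); last by lia.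
by rewrite addrCA.
Qed.

Lemma eq_balance (P Q : int -> bool) j j' k :
  (forall i : nat, P (j - i%:Z) = Q (j' - i%:Z)) ->
  balance P j k = balance Q j' k.
Proof. by move=> PQ; elim: k => // k IH; rewrite !balanceS IH PQ. Qed.

(** The balance starts at -1 and moves by steps of 1, so the first time it is nonnegative it equals
    0. *)
Lemma first_return_find (P : int -> bool) (j : int) (n : nat) :
  P j -> 0 <= balance P j n -> (0 < n)%N ->
  let k := find (fun k => 0 <= balance P j k.+1) (iota 0 n) in
  (k < n)%N /\ first_return P j k.
Proof.
move=> Pj jn n0 k; rewrite -(prednK n0) in jn; move: @k; set a := (fun k => _) => k.
have ha : has a (iota 0 n).
  by apply/hasP; exists n.-1 => //; rewrite mem_iota; lia.
have kn : (k < n)%N by rewrite -[X in (_ < X)%N](size_iota 0 n) -has_find.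
have ak : 0 <= balance P j k.+1.
  by have := nth_find 0%N ha; rewrite nth_iota.
have lk i : (i < k)%N -> balance P j i.+1 < 0.
  move=> ik; have := before_find 0%N ik; rewrite nth_iota; last by lia.
  by move/negbT; rewrite -ltNge.
split=> //; split=> //; case Ek : k ak lk => [|k'] ak lk.
  by move: ak; rewrite balance1 Pj.
have := lk k' ltac:(lia); move: ak; rewrite balanceS; case: ifP => _; lia.
Qed.

Lemma foldr_pastS (M : nat) (x : int -> dyck_alphabet M) s j k :
  foldr (@dyck_step M) s (past x j k.+1) =
  dyck_step (x (j - k%:Z)) (foldr (@dyck_step M) s (past x j k)).
Proof. by []. Qed.

(** Read leftwards, the closing at [j] pushes its label on the stack. While the balance stays
    negative this label is not popped, and the letter at [j - k] pops it. *)
Lemma matching_labels (M : nat) (x : int -> dyck_alphabet M) (j : int) (k : nat) :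
  dyck_shift M x -> closing (x j) -> first_return (closing \o x) j k ->
  label (x (j - k%:Z)) = label (x j).
Proof.
move=> /dyck_shiftP /(_ j k.+1) [s xD] xj [balk balN].
(* [p] holds the labels pushed above that of [j] and not yet popped; the height above [s] is minus
   the balance. *)
have stack m t : (m < k)%N ->
    foldr (@dyck_step M) (Some s) (past x j m.+1) = Some t ->
    exists2 p, t = p ++ label (x j) :: s &
      (size p)%:Z = - balance (closing \o x) j m.+1 - 1.
  elim: m t => [|m IH] t mk.
    rewrite balance1 /= subr0; case: (x j) xj => // i _ [<-].
    by exists [::].
  move=> tE; have := IH _ (ltnW mk); move: tE.
  rewrite foldr_pastS; case: foldr => [t'|]; last by case: (x _).
  have := balN _ mk; rewrite (balanceS _ _ m.+1) /=.
  case: (x (j - m.+1%:Z)) => [i|i] /= balm tE /(_ _ erefl) [p t'E sp]; last first.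
    by case: tE => <-; exists (i :: p); rewrite ?t'E//=; lia.
  move: tE; rewrite t'E; case: p sp t'E => [|i' p] /= sp _; first by lia.
  by case: eqP => // _ [<-]; exists p => //; lia.
case: k balk balN xD stack => [|k] balk balN xD stack.
  by move: balk; rewrite balance1 /= xj.
have := balN k (ltnSn k); have := stack k _ (ltnSn k); move: xD balk.
rewrite foldr_pastS balanceS [(closing \o x) _]/=.
case: foldr => [t|]; last by case: (x _).
case: (x (j - k.+1%:Z)) => i /=; last by lia.
move=> it bal0 /(_ _ erefl) [p tE sp] balk.
move: it; rewrite tE; case: p sp {tE} => [|i' p] /= sp; last by lia.
by case: ifP => // /eqP.
Qed.

Section MatchedIsDyck.
Context (M : nat) (x : int -> dyck_alphabet M).
Hypothesis x_matched : forall j, closing (x j) ->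
  exists2 k, first_return (closing \o x) j k & label (x (j - k%:Z)) = label (x j).
Context (J : int).
Let D (k : nat) : int := - balance (closing \o x) J k.

(* The level [l] of the stack after [k] letters is removed by the first later
   opening which brings the height below [l]. *)
Let item (k : nat) (l : int) : 'I_M := xget (label (x 0))
  [set c | exists k' : nat, [/\ (k <= k')%N, D k'.+1 < l,
     forall i, (k <= i < k')%N -> l <= D i.+1 & c = label (x (J - k'%:Z))]]%classic.

Let itemE (k k' : nat) (l : int) : (k <= k')%N -> D k'.+1 < l ->
  (forall i, (k <= i < k')%N -> l <= D i.+1) -> item k l = label (x (J - k'%:Z)).
Proof.
move=> kk' k'l lk'; apply: xget_unique; first by exists k'.
move=> c [k2 [kk2 k2l lk2 ->]]; suff -> : k2 = k' by [].
have [k2k'|k'k2|//] := ltngtP k2 k'.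
- by have := lk' k2 ltac:(lia); lia.
- by have := lk2 k' ltac:(lia); lia.
Qed.

(** If letter [k] does not remove level [l], the search for the removal may start one letter
    later. *)
Let itemS (k : nat) (l : int) : l <= D k.+1 -> item k.+1 l = item k l.
Proof.
move=> lk; rewrite /item; congr xget; apply/seteqP; split=> c [k' [kk' k'l lk' ->]];
  exists k'; split=> //.
- by lia.
- move=> m /andP[km mk']; have [km'|mk] := ltnP k m; first by apply: lk'; lia.
  by have -> : m = k by lia.
- by rewrite ltn_neqAle kk' andbT; apply/eqP => kE; move: k'l; rewrite -kE; lia.
- by move=> m km; apply: lk'; lia.
Qed.

(** The levels from [D k] down to 1 - K, top first. As [D k] is at least -k, the height K + [D k] is
    nonnegative for k <= K. *)
Let stack (K k : nat) : seq 'I_M :=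
  mkseq (fun r => item k (D k - r%:Z)) `|(K%:Z + D k)%R|%N.

Let mkseqSl (f : nat -> 'I_M) m : mkseq f m.+1 = f 0%N :: mkseq (f \o succn) m.
Proof. by rewrite /mkseq /= (iotaDl 1 0 m) -map_comp. Qed.

Let foldr_stack (K k : nat) : (k <= K)%N ->
  foldr (@dyck_step M) (Some (stack K 0)) (past x J k) = Some (stack K k).
Proof.
elim: k => [//|k IH] kK /=; rewrite IH; last by lia.
have Dk : D k.+1 = (if closing (x (J - k%:Z)) then 1 else -1) + D k.
  by rewrite /D balanceS opprD /=; case: closing.
have Db : `|D k| <= k%:Z by rewrite /D normrN balance_bound.
case xk: (x (J - k%:Z)) (Dk) => [i|i] /= {}Dk.
  (* An opening removes the top level [D k] at once, so the item stored there is its own label. *)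
  rewrite {1}/stack (_ : `|(K%:Z + D k)%R|%N = `|(K%:Z + D k.+1)%R|%N.+1); last by lia.
  rewrite mkseqSl subr0 (@itemE k k); first last.
  - by move=> ?; lia.
  - by lia.
  - by [].
  rewrite xk /= eqxx; congr Some; apply: eq_mkseq => r /=.
  by rewrite itemS; [congr item|]; lia.
rewrite {2}/stack (_ : `|(K%:Z + D k.+1)%R|%N = `|(K%:Z + D k)%R|%N.+1); last by lia.
rewrite mkseqSl subr0; congr (Some (_ :: _)); last first.
  apply: eq_mkseq => r /=.
  by rewrite -itemS; [congr item|]; lia.
(* The new level is removed by the opening matched with this closing. By hypothesis the labels
   agree, so the pushed label is the item of that level. *)
have [|m [bal0 balN]] := x_matched (j := J - k%:Z); first by rewrite xk.
rewrite xk /= => <-.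
have DkD n : D (k + n) = D k - balance (closing \o x) (J - k%:Z) n.
  by rewrite /D balanceD opprD.
rewrite (@itemE k.+1 (k + m)).
- by congr (label (x _)); lia.
- case: m {balN} bal0 => [|m _]; last by lia.
  by rewrite balance1 /= xk.
- by rewrite -addnS DkD bal0; lia.
- move=> n /andP[kn nm]; have := balN (n - k)%N ltac:(lia).
  by have := DkD (n - k).+1; rewrite (_ : (k + (n - k).+1)%N = n.+1); lia.
Qed.

Lemma matched_past (K : nat) :
  exists s, foldr (@dyck_step M) (Some s) (past x J K) != None.
Proof. by exists (stack K 0); rewrite foldr_stack. Qed.

End MatchedIsDyck.

Lemma matched_dyck_shift (M : nat) (x : int -> dyck_alphabet M) :
  (forall j, closing (x j) -> exists2 k,
    first_return (closing \o x) j k & label (x (j - k%:Z)) = label (x j)) ->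
  dyck_shift M x.
Proof. by move=> xm; apply/dyck_shiftP => j k; exact: matched_past. Qed.

(** * Periodic points *)

Section PeriodicExtension.
Context (T : Type) (n : nat).

Definition periodic (x : int -> T) := iter n.+1 (@Defs.shift T) x = x.

Definition periodize (w : {ffun 'I_n.+1 -> T}) (i : int) : T :=
  w (inord `|(i %% n.+1%:Z)%Z|%N).

Lemma periodicP (x : int -> T) :
  periodic x <-> forall i, x (i + n.+1%:Z) = x i.
Proof.
split=> [xn i|xn]; first by rewrite -iter_shiftE xn.
by apply/funext => i; rewrite iter_shiftE xn.
Qed.

Lemma periodize_ord (w : {ffun 'I_n.+1 -> T}) (i : 'I_n.+1) :
  periodize w (i : nat)%:Z = w i.
Proof.
rewrite /periodize modz_small; last by have := ltn_ord i; lia.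
by rewrite absz_nat inord_val.
Qed.

Lemma periodizeP (w : {ffun 'I_n.+1 -> T}) : periodic (periodize w).
Proof.
by apply/periodicP => i; rewrite /periodize -[X in i + X]mul1r addrC modzMDl.
Qed.

Lemma periodizeD (w : {ffun 'I_n.+1 -> T}) (i : int) :
  periodize w (i + n.+1%:Z) = periodize w i.
Proof. by move: i; apply/periodicP; exact: periodizeP. Qed.

Lemma periodicM (x : int -> T) (q i : int) :
  periodic x -> x (q * n.+1%:Z + i) = x i.
Proof.
move=> /periodicP xn; elim/int_ind: q => [|q IH|q IH].
- by rewrite mul0r add0r.
- by rewrite -IH -[RHS]xn; congr x; rewrite (intS q); ring.
- by rewrite -IH -[LHS]xn; congr x; rewrite (intS q); ring.
Qed.

Lemma periodicE (x : int -> T) :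
  periodic x -> x = periodize [ffun i : 'I_n.+1 => x (i : nat)%:Z].
Proof.
move=> xn; apply/funext => i; rewrite /periodize ffunE /= inordK.
  rewrite gez0_abs ?modz_ge0// -(periodicM (i %/ n.+1%:Z)%Z (i %% n.+1%:Z)%Z xn).
  by rewrite -divz_eq.
by rewrite -ltz_nat gez0_abs ?modz_ge0// ltz_pmod.
Qed.

Lemma periodize_inj : injective periodize.
Proof.
by move=> v w vw; apply/ffunP => i; rewrite -!periodize_ord vw.
Qed.

End PeriodicExtension.

(** Sliding the window by one place drops and adds the same letter, so the balance over a period is
    independent of [j]; at [j = n] it is a sum over the letters of [w]. *)
Lemma balance_period (T : Type) (n : nat) (w : {ffun 'I_n.+1 -> T})
    (P : T -> bool) (j : int) :
  balance (P \o periodize w) j n.+1 = n.+1%:Z - (#|[set i | P (w i)]|%:Z) *+ 2.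
Proof.
set Q := P \o periodize w.
have Qn i : Q (i + n.+1%:Z) = Q i.
  by rewrite /Q /= periodizeD.
have shiftQ i : balance Q (i + 1) n.+1 = balance Q i n.+1.
  have := balanceD Q (i + 1) 1 n.+1; have := balanceD Q (i + 1) n.+1 1.
  rewrite addn1 add1n => -> ; rewrite addrK !balance1.
  by rewrite -(Qn (i + 1 - n.+1%:Z)) subrK; lia.
have -> : balance Q j n.+1 = balance Q n n.+1.
  have shiftZ (q i : int) : balance Q (i + q) n.+1 = balance Q i n.+1.
    elim/int_ind: q => [|q IH|q IH]; first by rewrite addr0.
    - by rewrite -IH -[RHS]shiftQ; congr balance; lia.
    - by rewrite -IH -[LHS]shiftQ; congr balance; lia.
  by rewrite -(shiftZ (j - n%:Z) n%:Z); congr balance; lia.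
have -> : balance Q n n.+1 = \sum_(i < n.+1) (if Q (n%:Z - i%:Z) then -1 else 1).
  elim: n.+1 => [|k IH]; first by rewrite big_ord0.
  by rewrite big_ord_recr /= balanceS IH addrC.
rewrite (reindex_inj rev_ord_inj) /=.
rewrite (eq_bigr (fun i : 'I_n.+1 => 1 - (P (w i))%:Z *+ 2)); last first.
  move=> i _; rewrite /Q /= (_ : n%:Z - (n.+1 - i.+1)%N%:Z = i%:Z); last first.
    by have := ltn_ord i; lia.
  by rewrite periodize_ord; case: (P _).
rewrite big_split /= sumr_const card_ord sumrN sumrMnl natz; congr (_ - _ *+ 2).
rewrite -sum1_card [in RHS]big_mkcond /= (big_morph Posz PoszD erefl).
apply: eq_bigr => i _.
by rewrite inE; case: (P _).
Qed.

Definition dyck_words (M n b : nat) : {set {ffun 'I_n.+1 -> dyck_alphabet M}} :=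
  [set w | `[< dyck_shift M (periodize w) >] & #|[set i | closing (w i)]| == b].

(** Reflecting the positions 0, ..., n and exchanging brackets is injective and turns b closings
    into n + 1 - b. Used for both numbers, the inequality becomes an equality. *)
Lemma dyck_words_rev (M n b : nat) : (b <= n.+1)%N ->
  (#|dyck_words M n b| <= #|dyck_words M n (n.+1 - b)|)%N.
Proof.
move=> bn.
pose rv (w : {ffun 'I_n.+1 -> dyck_alphabet M}) :=
  [ffun i => dyck_flip (w (rev_ord i))].
have rvK : involutive rv.
  by move=> w; apply/ffunP => i; rewrite !ffunE rev_ordK dyck_flipK.
rewrite -(card_imset _ (inv_inj rvK)).
apply/subset_leq_card/fintype.subsetP => _ /imsetP[w wDb ->].
move: wDb; rewrite !inE => /andP[/asboolP wD /eqP wb]; apply/andP; split.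
  apply/asboolP.
  have := dyck_shift_rev (c := n%:Z) wD; congr (dyck_shift M).
  set y := (X in X = _); have yP : periodic n y.
    apply/periodicP => i; rewrite /y; congr dyck_flip.
    by rewrite -[LHS]periodizeD; congr periodize; lia.
  rewrite (periodicE yP); congr periodize; apply/ffunP => i; rewrite !ffunE /y.
  rewrite (_ : n%:Z - (i : nat)%:Z = (rev_ord i : nat)%:Z) ?periodize_ord//=.
  by have := ltn_ord i; lia.
have -> : [set i | closing (rv w i)] = (@rev_ord n.+1) @: ~: [set i | closing (w i)].
  apply/setP => i; rewrite inE -[X in X \in _]rev_ordK mem_imset; last first.
    exact: rev_ord_inj.
  by rewrite !inE ffunE; case: (w _).
rewrite card_imset; last exact: rev_ord_inj.
by rewrite cardsCs finset.setCK card_ord wb.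
Qed.

(** * Counting words with at most half of the letters closing *)

Section CountDyckWords.
Context (M n b : nat) (i0 : 'I_M).
Hypothesis b_small : (b.*2 <= n.+1)%N.

(* [p.1] is the set of closings, where the labels [p.2] are normalised to [i0]. *)
Let shapes : {set {set 'I_n.+1} * {ffun 'I_n.+1 -> 'I_M}} :=
  [set p : {set 'I_n.+1} * {ffun 'I_n.+1 -> 'I_M} |
    (#|p.1| == b) && (p.2 \in pffun_on i0 (mem (~: p.1)) predT)].

Let card_shapes : #|shapes| = ('C(n.+1, b) * M ^ (n.+1 - b))%N.
Proof.
rewrite -sum1_card (eq_bigl (fun p : {set 'I_n.+1} * {ffun 'I_n.+1 -> 'I_M} =>
  (#|p.1| == b) &&
  (p.2 \in pffun_on i0 (mem (~: p.1)) predT))); last by move=> p; rewrite inE.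
rewrite -(pair_big_dep (fun S : {set 'I_n.+1} => #|S| == b)
  (fun S c => c \in pffun_on i0 (mem (~: S)) predT) (fun _ _ => 1%N)) /=.
rewrite (eq_bigr (fun=> (M ^ (n.+1 - b))%N)); last first.
  move=> S /eqP Sb; rewrite sum1_card card_pffun_on.
  by rewrite cardsCs finset.setCK Sb !card_ord.
by rewrite sum_nat_const -cardsE card_draws card_ord.
Qed.

Let shape_of (w : {ffun 'I_n.+1 -> dyck_alphabet M}) :
    {set 'I_n.+1} * {ffun 'I_n.+1 -> 'I_M} :=
  ([set i | closing (w i)], [ffun i => if closing (w i) then i0 else label (w i)]).

Let balance_ge0 (T : Type) (w : {ffun 'I_n.+1 -> T}) (P : T -> bool) (j : int) :
  #|[set i | P (w i)]| = b -> 0 <= balance (P \o periodize w) j n.+1.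
Proof. by rewrite balance_period => ->; lia. Qed.

Let return_time (P : int -> bool) (j : int) : nat :=
  find (fun k => 0 <= balance P j k.+1) (iota 0 n.+1).

(** The balance is negative just before the return and 0 at it, so the last letter read is an
    opening. *)
Let return_timeP (P : int -> bool) (j : int) :
  P j -> 0 <= balance P j n.+1 ->
  first_return P j (return_time P j) /\ ~~ P (j - (return_time P j)%:Z).
Proof.
move=> Pj /(first_return_find Pj) /(_ isT) [_]; rewrite -/(return_time P j).
move=> [bal0 balN]; split=> //; move: bal0 balN.
case: (return_time P j) => [|k]; first by rewrite balance1 Pj.
by rewrite balanceS => kE /(_ _ (ltnSn k)); move: kE; case: (P _) => //; lia.
Qed.

(** The set of closings fixes all return times, so the label of a closing is that of an opening
    recorded in the shape. *)
Let shape_of_inj : {in dyck_words M n b &, injective shape_of}.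
Proof.
move=> v w; rewrite !inE => /andP[/asboolP vD /eqP vb] /andP[/asboolP wD _].
move=> [/setP vwS /ffunP vwc]; apply: (@periodize_inj _ n); apply/funext.
have vwP i : closing (periodize v i) = closing (periodize w i).
  by rewrite /periodize; have := vwS (inord `|(i %% n.+1%:Z)%Z|%N); rewrite !inE.
have vwL i : ~~ closing (periodize v i) ->
    label (periodize v i) = label (periodize w i).
  move=> vi; have := vwc (inord `|(i %% n.+1%:Z)%Z|%N).
  by rewrite !ffunE -!/(periodize _ i) -vwP (negPf vi).
have vwPE : closing \o periodize v = closing \o periodize w.
  by apply/funext => i /=.
have eqc (c d : dyck_alphabet M) :
  closing c = closing d -> label c = label d -> c = d.
  by case: c d => [i|i] [j|j] //= _ ->.
move=> j; apply: eqc; first exact: vwP.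
have [vj|] := boolP (closing (periodize v j)); last exact: vwL.
(* At most half of the letters close, so the balance over a period is nonnegative and a match is
   found within one period. *)
have [fr vN] := return_timeP (P := closing \o periodize v) vj
  (balance_ge0 (P := closing) j vb).
rewrite -(matching_labels vD vj fr) vwL//.
by apply: matching_labels => //; rewrite -?vwP// -vwPE.
Qed.

Let shape_of_words : shape_of @: dyck_words M n b \subset shapes.
Proof.
apply/fintype.subsetP => _ /imsetP[w wDb ->]; move: wDb; rewrite !inE => /andP[_ ->] /=.
apply/pffun_onP; split=> //; apply/fintype.subsetP => i; rewrite !inE ffunE.
by case: ifP => //; rewrite eqxx.
Qed.

(** The inverse of [shape_of]: each closing copies the label of its matched opening. [periodize
    [ffun i => i]] reduces an integer modulo [n.+1]. *)
Let word_of (p : {set 'I_n.+1} * {ffun 'I_n.+1 -> 'I_M}) (j : int) :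
    dyck_alphabet M :=
  let P := mem p.1 \o periodize [ffun i => i] in
  if P j then inr (periodize p.2 (j - (return_time P j)%:Z))
  else inl (periodize p.2 j).

Let word_of_periodic p : periodic n (word_of p).
Proof.
apply/periodicP => j; rewrite /word_of.
set P := mem p.1 \o _.
have Pn i : P (i + n.+1%:Z) = P i.
  by rewrite /P /= periodizeD.
rewrite Pn; case: ifP => _; last first.
  by rewrite periodizeD.
have -> : return_time P (j + n.+1%:Z) = return_time P j.
  rewrite /return_time; apply: eq_find => k; congr (_ <= _).
  by apply: eq_balance => i; rewrite addrAC Pn.
by rewrite addrAC periodizeD.
Qed.

Let word_of_shift p : p \in shapes -> dyck_shift M (word_of p).
Proof.
rewrite inE => /andP[/eqP pb _]; apply: matched_dyck_shift => j.
set P := mem p.1 \o periodize [ffun i => i].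
have wP : closing \o word_of p = P.
  by apply/funext => i; rewrite /= /word_of -/P; case: ifP.
have -> : closing (word_of p j) = P j by rewrite -wP.
move=> Pj; rewrite wP; have [|fr PN] := return_timeP Pj.
  apply: (balance_ge0 (P := mem p.1)); rewrite -pb; congr #|pred_of_set _|.
  by apply/setP => i; rewrite inE ffunE.
exists (return_time P j) => //; rewrite /word_of -/P (negPf PN) /=.
by move: Pj => /= ->.
Qed.

Let shapes_le : (#|shapes| <= #|dyck_words M n b|)%N.
Proof.
pose g p := [ffun i : 'I_n.+1 => word_of p (i : nat)%:Z].
have gE p : periodize (g p) = word_of p by rewrite -periodicE.
have P_ord (p : {set 'I_n.+1} * {ffun 'I_n.+1 -> 'I_M}) (i : 'I_n.+1) :
    (mem p.1 \o periodize [ffun i => i]) (i : nat)%:Z = (i \in p.1).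
  by rewrite /= periodize_ord ffunE.
have gC p i : closing (g p i) = (i \in p.1).
  by rewrite ffunE /word_of P_ord; case: ifP.
have gK : {in shapes, cancel g shape_of}.
  move=> [S c]; rewrite inE => /andP[_ /pffun_onP[/fintype.subsetP cS _]].
  rewrite /shape_of; congr pair; first by apply/setP => i; rewrite inE gC.
  apply/ffunP => i; rewrite [LHS]ffunE gC /=; case: ifP => iS; last first.
    by rewrite ffunE /word_of P_ord iS /= periodize_ord.
  (* At a closing, [c] takes the value [i0] because its support avoids [S]. *)
  have := cS i; rewrite !inE iS; case: eqP => // _ /(_ isT) //.
rewrite -(card_in_imset (can_in_inj gK)); apply/subset_leq_card/fintype.subsetP.
move=> _ /imsetP[p pS ->]; rewrite inE gE; apply/andP; split.
  by apply/asboolP/word_of_shift.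
move: (pS); rewrite inE => /andP[/eqP <- _]; apply/eqP; congr #|pred_of_set _|.
by apply/setP => i; rewrite inE gC.
Qed.

Lemma card_dyck_words_small : #|dyck_words M n b| = ('C(n.+1, b) * M ^ (n.+1 - b))%N.
Proof.
rewrite -card_shapes; apply/eqP; rewrite eqn_leq shapes_le andbT.
by rewrite -(card_in_imset shape_of_inj) subset_leq_card.
Qed.

End CountDyckWords.

Lemma card_dyck_words (M n b : nat) : (0 < M)%N -> (b <= n.+1)%N ->
  #|dyck_words M n b| = ('C(n.+1, b) * M ^ maxn b (n.+1 - b))%N.
Proof.
move=> M0 bn; pose i0 := Ordinal M0.
have [bs|bl] := leqP b.*2 n.+1.
  by rewrite (card_dyck_words_small i0 bs); congr (_ * M ^ _)%N; lia.
have -> : #|dyck_words M n b| = #|dyck_words M n (n.+1 - b)|.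
  apply/eqP; rewrite eqn_leq dyck_words_rev//=.
  by rewrite -{2}(subKn bn) dyck_words_rev//; lia.
rewrite (card_dyck_words_small i0); last by lia.
by rewrite bin_sub//; congr (_ * M ^ _)%N; lia.
Qed.

(** * The law of the Birkhoff averages *)

(** Here [n] is the period itself, whereas [dyck_words M n b] has period [n.+1]. *)
Definition dyck_count (M n b : nat) : nat := ('C(n, b) * M ^ maxn b (n - b))%N.

Definition dyck_total (M n : nat) : nat := (\sum_(b < n.+1) dyck_count M n b)%N.

Lemma birkhoff_sum_dyck_obs (R : realType) (M m : nat)
    (w : {ffun 'I_m.+1 -> dyck_alphabet M}) :
  birkhoff_sum (dyck_obs R M) m.+1 (periodize w) = #|[set i | closing (w i)]|%:R.
Proof.
rewrite /birkhoff_sum big_mkord -sum1_card natr_sum [RHS]big_mkcond /=.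
apply: eq_bigr => i _; rewrite inE /dyck_obs iter_shiftE add0r periodize_ord.
by case: (w i).
Qed.

(** The Birkhoff average of a periodic point is its number of closings per period over the period;
    the points are sorted by that number. *)
Lemma card_dyck_per (R : realType) (M m : nat) (B : set R) : (0 < M)%N ->
  #|` fset_set ([set x | dyck_per M m.+1 x /\
        B (m.+1%:R^-1 * birkhoff_sum (dyck_obs R M) m.+1 x)]%classic) | =
  (\sum_(b < m.+2 | `[< B (b%:R / m.+1%:R) >]) dyck_count M m.+1 b)%N.
Proof.
move=> M0; set S := (X in fset_set X).
pose D := [set w : {ffun 'I_m.+1 -> dyck_alphabet M} |
  `[< dyck_shift M (periodize w) >] &
  `[< B (#|[set i | closing (w i)]|%:R / m.+1%:R) >]].
have -> : fset_set S = [fset periodize w | w in D]%fset.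
  have finS : finite_set S.
    by apply: sub_finite_set (dyck_per_finite M (ltn0Sn m)) => x [].
  apply/fsetP => x; rewrite in_fset_set//; apply/idP/imfsetP => /=.
    rewrite inE => -[[xD xP] Bx]; have xE := periodicE xP.
    exists [ffun i : 'I_m.+1 => x (i : nat)%:Z] => //; rewrite inE -xE.
    apply/andP; split; first exact/asboolP.
    by apply/asboolP; move: Bx; rewrite {1}xE birkhoff_sum_dyck_obs mulrC.
  move=> [w]; rewrite !inE => /andP[/asboolP wD /asboolP Bw] ->.
  split; first by split=> //; exact: periodizeP.
  by rewrite birkhoff_sum_dyck_obs mulrC.
rewrite card_imfset; last exact: periodize_inj.
rewrite -cardE -sum1_card.
pose p (w : {ffun 'I_m.+1 -> dyck_alphabet M}) : 'I_m.+2 :=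
  inord #|[set i | closing (w i)]|.
have pE w : p w = #|[set i | closing (w i)]| :> nat.
  by rewrite inordK// ltnS (leq_trans (max_card _))// card_ord.
rewrite (partition_big p (fun b => `[< B (b%:R / m.+1%:R) >])); last first.
  by move=> w; rewrite inE pE => /andP[].
apply: eq_bigr => b /asboolP Bb.
rewrite sum1dep_card /dyck_count -card_dyck_words//; last by rewrite -ltnS.
apply: eq_card => w; rewrite !inE -(inj_eq val_inj) /= pE.
by case: eqP => [->|]; rewrite ?andbF// (asboolT Bb) !andbT.
Qed.

Lemma dyck_lawE (R : realType) (M : nat) (hM : (2 <= M)%N) (m : nat) (B : set R) :
  dyck_law R hM m B =
  ((\sum_(b < m.+2 | `[< B (b%:R / m.+1%:R) >]) dyck_count M m.+1 b)%N%:R /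
   (dyck_total M m.+1)%:R)%:E.
Proof.
have M0 := ltnW hM; rewrite /dyck_law /= /uniform_law card_dyck_per//.
congr (_ / _%:R)%:E; rewrite /dyck_total.
have := @card_dyck_per R M m setT M0.
rewrite (eq_bigl xpredT); last by move=> b; exact: asboolT.
by move=> <-; congr #|` fset_set _|; apply/seteqP; split=> [x|x []].
Qed.

(** * Entropy of the counts *)

(** The sequence b^k / k! is largest at k = b, since consecutive terms have ratio b / (k + 1). *)
Lemma fact_expn_le (b k : nat) : (b`! * b ^ k <= k`! * b ^ b)%N.
Proof.
have up m : (b`! * b ^ (b + m) <= (b + m)`! * b ^ b)%N.
  elim: m => [|m IH]; first by rewrite addn0.
  rewrite addnS expnS factS mulnCA -mulnA leq_mul//.
  by apply: leq_trans (leq_addr m b) (leqnSn _).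
have down m : (m <= b)%N -> (b`! * b ^ (b - m) <= (b - m)`! * b ^ b)%N.
  elim: m => [|m IH] mb; first by rewrite subn0.
  have b0 : (0 < b)%N by lia.
  rewrite -(leq_pmul2l b0) mulnCA -expnS (_ : (b - m.+1).+1 = b - m)%N; last lia.
  apply: leq_trans (IH (ltnW mb)) _.
  rewrite (_ : (b - m)%N = (b - m.+1).+1); last by lia.
  by rewrite factS mulnA leq_mul// leq_mul//; lia.
have [kb|bk] := leqP k b; first by rewrite -(subKn kb) down// leq_subr.
by rewrite -(subnKC (ltnW bk)) up.
Qed.

(* The largest of the [n + 1] terms of the binomial expansion of
   [(b + (n - b)) ^ n] is the one of index [b]. *)
Lemma bin_entropy_nat (n b : nat) : (b <= n)%N ->
  ('C(n, b) * (b ^ b * (n - b) ^ (n - b)) <= n ^ n)%N /\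
  (n ^ n <= n.+1 * ('C(n, b) * (b ^ b * (n - b) ^ (n - b))))%N.
Proof.
move=> bn; set t := fun k => ('C(n, k) * (b ^ k * (n - b) ^ (n - k)))%N.
have -> : (n ^ n = \sum_(k < n.+1) t k)%N.
  rewrite -{1}(subnK bn) expnDn; apply: eq_bigr => k _.
  by rewrite /t [in RHS](mulnC (b ^ k)%N).
split; first by rewrite (bigD1 (inord b)) //= inordK ?ltnS// leq_addr.
have -> : (n.+1 * t b = \sum_(k < n.+1) t b)%N.
  by rewrite sum_nat_const card_ord.
apply: leq_sum => -[k /=]; rewrite ltnS => kn _.
have := bin_fact kn; have := bin_fact bn.
have := leq_mul (fact_expn_le b k) (fact_expn_le (n - b) (n - k)).
have : (0 < k`! * (n - k)`! * (b`! * (n - b)`!))%N by rewrite !muln_gt0 !fact_gt0.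
rewrite /t; set x := (_ ^ k)%N; set y := (_ ^ b)%N.
set x' := (_ ^ (n - k))%N; set y' := (_ ^ (n - b))%N => pos le eb ek.
(* Multiplied by all the factorials, [t k <= t b] becomes the product of the instances of
   [fact_expn_le] for (b, k) and (n - b, n - k). *)
rewrite -(leq_pmul2r pos).
have -> : ('C(n, k) * (x * x') * (k`! * (n - k)`! * (b`! * (n - b)`!)) =
  n`! * (b`! * x * ((n - b)`! * x')))%N by rewrite -ek; ring.
have -> : ('C(n, b) * (y * y') * (k`! * (n - k)`! * (b`! * (n - b)`!)) =
  n`! * (k`! * y * ((n - k)`! * y')))%N by rewrite -eb; ring.
by rewrite leq_mul2l le orbT.
Qed.

Section Entropy.
Context (R : realType).
Implicit Types (t x : R) (n b M : nat).

Definition xlnx x : R := x * ln x.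

Lemma ln_natX b : ln ((b ^ b)%N%:R : R) = xlnx b%:R.
Proof.
case: b => [|b]; first by rewrite expn0 ln1 /xlnx mul0r.
by rewrite natrX lnXn ?ltr0n// /xlnx mulr_natl.
Qed.

Lemma xlnx_scale n b : (0 < n)%N ->
  n%:R * xlnx (b%:R / n%:R) = xlnx b%:R - b%:R * ln (n%:R : R).
Proof.
rewrite lt0n => n0; have nE : n%:R != 0 :> R by rewrite pnatr_eq0.
rewrite /xlnx; case: b => [|b]; first by rewrite !(mul0r, mulr0) subr0.
by rewrite ln_div ?posrE ?ltr0n ?lt0n//; field.
Qed.

Definition entropy t : R := - (xlnx t + xlnx (1 - t)).

(** As n^n / (b^b (n-b)^(n-b)) is exp (n H(b/n)), this is the logarithm of [bin_entropy_nat]. *)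
Lemma ln_bin_entropy n b : (0 < n)%N -> (b <= n)%N ->
  n%:R * entropy (b%:R / n%:R) - ln n.+1%:R <= ln ('C(n, b)%:R : R) <=
  n%:R * entropy (b%:R / n%:R).
Proof.
move=> n0 bn; have nE : (n%:R : R) != 0 by rewrite pnatr_eq0 -lt0n.
have tE : 1 - b%:R / n%:R = (n - b)%:R / n%:R :> R.
  by rewrite natrB// mulrBl divff.
have nH : n%:R * entropy (b%:R / n%:R) =
    xlnx n%:R - (xlnx b%:R + xlnx (n - b)%:R) :> R.
  rewrite /entropy tE mulrN mulrDr !xlnx_scale// natrB// /xlnx; ring.
have pos k : (0 < (k ^ k)%N%:R :> R).
  by rewrite ltr0n; case: k => // k; rewrite expn_gt0.
have C0 : (0 < 'C(n, b)%:R :> R) by rewrite ltr0n bin_gt0.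
have [hi lo] := bin_entropy_nat bn; move: hi lo; rewrite -!(ler_nat R) !natrM.
have P0 := mulr_gt0 (pos b) (pos (n - b)%N); have CP0 := mulr_gt0 C0 P0.
have nn0 := pos n.
move=> hi lo; rewrite -ler_ln ?posrE// in hi.
rewrite -ler_ln ?posrE// in lo; last by rewrite mulr_gt0.
move: hi lo; rewrite !lnM ?posrE ?mulr_gt0 ?pos// ?ltr0n// !ln_natX nH => hi lo.
by apply/andP; split; lra.
Qed.

Section DyckCount.
Context (M : nat) (M0 : (0 < M)%N).
Let m0 : (0 < M%:R :> R). Proof. by rewrite ltr0n. Qed.

(** Both finite branches of the rate in one formula, continuous on the whole line. On [0, 1] it is
    the relative entropy of (s, 1 - s) with respect to (M/(M+1), 1/(M+1)), where s = max(t, 1 -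
    t). *)
Definition dyck_rate_fun t : R :=
  ln M.+1%:R - entropy t - Num.max t (1 - t) * ln M%:R.

Lemma dyck_rateE t :
  dyck_rate R M t = if 0 <= t <= 1 then (dyck_rate_fun t)%:E else +oo%E.
Proof.
rewrite /dyck_rate /dyck_rate_fun /entropy -/(xlnx t) -/(xlnx (1 - t)).
have lnE s : ln (M.+1%:R / M%:R `^ s) = ln M.+1%:R - s * ln M%:R :> R.
  by rewrite ln_div ?posrE ?ltr0n ?powR_gt0// ln_powR.
rewrite !lnE; have [|] := boolP (0 <= t <= 2^-1) => [/andP[t0 t1]|].
  rewrite t0 /= (_ : t <= 1); last by lra.
  by rewrite (_ : Num.max _ _ = 1 - t); [congr _%:E; ring|rewrite max_r//; lra].
rewrite negb_and -!ltNge => tN; case: ifPn => [/andP[th t1]|].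
  rewrite t1 (_ : 0 <= t) /=; last by lra.
  by rewrite (_ : Num.max _ _ = t); [congr _%:E; ring|rewrite max_l//; lra].
move=> tN'; rewrite ifF//; apply/negP => /andP[t0 t1].
by move: tN tN'; rewrite t1 andbT -leNgt ltNge t0 /= => /lt_le_trans h /h; rewrite ltxx.
Qed.

Lemma dyck_rate_fun_ge0 t : 0 <= t <= 1 -> 0 <= dyck_rate_fun t.
Proof.
move=> /andP[t0 t1].
(* Gibbs' inequality against the probability vector (p, 1 - p). *)
have gibbs s p : 0 <= s -> 0 < p -> s * ln p + s - p <= xlnx s.
  rewrite le_eqVlt => /orP[/eqP <-|s0] p0.
    by rewrite /xlnx !mul0r; lra.
  have : ln (p / s) <= p / s - 1.
    have -> : p / s = 1 + (p / s - 1) by ring.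
    rewrite addrAC subrr add0r; apply: le_ln1Dx.
    by rewrite ltrBrDr addNr divr_gt0.
  rewrite ln_div ?posrE// -(ler_pM2l s0) mulrBr mulrBr mulr1 mulrCA divff ?gt_eqF//.
  by rewrite mulr1 /xlnx; lra.
have M1 : (0 < M.+1%:R :> R) by rewrite ltr0n.
have M10 : M.+1%:R != 0 :> R by rewrite gt_eqF.
(* Adding [gibbs] for s against M/(M+1) and for 1 - s against 1/(M+1) cancels the terms without
   logarithm. *)
have ge (s : R) : 0 <= s <= 1 ->
    0 <= ln M.+1%:R + (xlnx s + xlnx (1 - s)) - s * ln (M%:R : R).
  move=> /andP[s0 s1].
  have := @gibbs s (M%:R / M.+1%:R) s0 (divr_gt0 m0 M1).
  have := @gibbs (1 - s) (M.+1%:R^-1) ltac:(lra) ltac:(by rewrite invr_gt0).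
  rewrite ln_div ?posrE// lnV ?posrE//.
  have -> : M%:R / M.+1%:R = 1 - M.+1%:R^-1 :> R.
    by apply: (mulIf M10); rewrite mulrBl mulVf// divfK// -natr1; ring.
  move: (ln _) (ln _) (_^-1) (xlnx s) (xlnx (1 - s)) => l m p u v vl um.
  rewrite -subr_ge0 in vl; rewrite -subr_ge0 in um; apply: le_trans (addr_ge0 vl um) _.
  by rewrite -subr_ge0 le_eqVlt; apply/orP; left; apply/eqP; ring.
rewrite /dyck_rate_fun /entropy opprK /Num.max; case: ifP => _; last first.
  by apply: ge; rewrite t0.
by have := ge (1 - t); rewrite subKr [xlnx (1 - t) + _]addrC; apply; lra.
Qed.

(** M^max(b, n-b) lies between M^b and M^b + M^(n-b), and weighting either power by C(n, b) sums to
    (M+1)^n. *)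
Lemma dyck_total_bounds n :
  (M.+1 ^ n <= dyck_total M n <= 2 * M.+1 ^ n)%N.
Proof.
have expl : (M.+1 ^ n = \sum_(i < n.+1) 'C(n, i) * M ^ i)%N.
  by rewrite -add1n expnDn; apply: eq_bigr => i _; rewrite exp1n mul1n.
have expr : (M.+1 ^ n = \sum_(i < n.+1) 'C(n, i) * M ^ (n - i))%N.
  by rewrite -addn1 expnDn; apply: eq_bigr => i _; rewrite exp1n muln1.
rewrite /dyck_total /dyck_count; apply/andP; split.
  by rewrite expl; apply: leq_sum => i _; rewrite leq_mul2l leq_pexp2l ?leq_maxl ?orbT.
rewrite mul2n -addnn {1}expl expr -big_split /=; apply: leq_sum => i _.
rewrite -mulnDr leq_mul2l; apply/orP; right.
by rewrite /maxn; case: ifP => _; rewrite ?leq_addr ?leq_addl.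
Qed.

(** The loss ln (n + 1) comes from the binomial coefficient, the loss ln 2 from the total count. *)
Lemma dyck_count_bounds n b : (0 < n)%N -> (b <= n)%N ->
  - (n%:R * dyck_rate_fun (b%:R / n%:R)) - ln n.+1%:R - ln 2 <=
    ln ((dyck_count M n b)%:R / (dyck_total M n)%:R : R) <=
  - (n%:R * dyck_rate_fun (b%:R / n%:R)).
Proof.
move=> n0 bn; have nE : (n%:R : R) != 0 by rewrite pnatr_eq0 -lt0n.
have C0 : (0 < 'C(n, b)%:R :> R) by rewrite ltr0n bin_gt0.
have := dyck_total_bounds n; rewrite -!(ler_nat R) => /andP[Zlo Zhi].
have M1 : (0 < (M.+1 ^ n)%N%:R :> R) by rewrite ltr0n expn_gt0.
have Z0 := lt_le_trans M1 Zlo.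
rewrite ln_div ?posrE//; last by rewrite natrM mulr_gt0// natrX exprn_gt0.
have -> : ln ((dyck_count M n b)%:R : R) =
    ln 'C(n, b)%:R + n%:R * (Num.max (b%:R / n%:R) (1 - b%:R / n%:R) * ln M%:R).
  rewrite /dyck_count natrM lnM ?posrE// natrX ?exprn_gt0// lnXn//.
  congr (_ + _); rewrite mulrA -[LHS]mulr_natl; congr (_ * _).
  have -> : 1 - b%:R / n%:R = (n - b)%:R / n%:R :> R.
    by rewrite natrB// mulrBl divff.
  by rewrite -maxr_pMl ?invr_ge0// mulrC divfK// -natr_max maxEnat.
have /andP[Clo Chi] := ln_bin_entropy n0 bn.
have lnZ : n%:R * ln (M.+1%:R : R) <= ln ((dyck_total M n)%:R : R) <=
    ln 2 + n%:R * ln (M.+1%:R : R).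
  rewrite mulr_natl -lnXn ?ltr0n// -natrX -lnM ?posrE// -natrM.
  by rewrite !ler_ln ?posrE// ?Zlo ?Zhi// natrM mulr_gt0.
move: lnZ => /andP[lo hi]; rewrite /dyck_rate_fun !mulrBr.
by apply/andP; split; lra.
Qed.

End DyckCount.
End Entropy.

(** * Rate functions *)

Local Open Scope classical_set_scope.

Section LimSupInf.
Context (R : realType).
Implicit Types (u v : (\bar R)^nat) (x : \bar R).

Lemma limn_esup_le u x : (\forall n \near \oo, u n <= x)%E -> (limn_esup u <= x)%E.
Proof.
move=> ux; apply: ge_ereal_inf; exists (ereal_sup (u @` [set n | u n <= x]%E)).
  by exists [set n | u n <= x]%E.
by apply: ge_ereal_sup => _ [n /= unx <-].
Qed.

Lemma limn_einf_ge u x : (\forall n \near \oo, x <= u n)%E -> (x <= limn_einf u)%E.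
Proof.
move=> xu; rewrite /limn_einf leeNr; apply: limn_esup_le.
by apply: filterS xu => n; rewrite leeN2.
Qed.

Lemma le_limn_esup u v : (forall n, u n <= v n)%E -> (limn_esup u <= limn_esup v)%E.
Proof.
move=> uv; apply: le_ereal_inf_tmp => _ [V Voo <-].
apply: ge_ereal_inf; exists (ereal_sup (u @` V)); first by exists V.
apply: ge_ereal_sup => _ [n Vn <-]; apply: le_trans (uv n) _.
by apply: ereal_sup_ubound; exists n.
Qed.

End LimSupInf.

(** * Uniqueness of the rate function *)

Section LDPUnique.
Context (R : realType) (X : ptopologicalType) (X_regular : regular_space X).
Context (mu : nat -> probability (borel X) R).

(** If [J1 x < a < J2 x], semicontinuity of [J2] and regularity give a neighbourhood [B] of [x] with
    [J2 > a] on its closure. The lower bound on the interior of [B] and the upper bound on its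
    closure force [- J1 x <= - a]. *)
Let LDP_le (J1 J2 : X -> \bar R) (x : X) : LDP mu J1 -> LDP mu J2 ->
  (J2 x <= J1 x)%E.
Proof.
move=> [J1ge0 _ J1lb _] [_ J2lsc _ J2ub]; rewrite leNgt; apply/negP => J12.
have [a J1a aJ2] : exists2 a : R, (J1 x < a%:E)%E & (a%:E < J2 x)%E.
  case: (J1 x) (J1ge0 x) J12 => [r _|_|]; last by [].
  - case: (J2 x) => [s|_|//].
    + rewrite lte_fin => rs; exists ((r + s) / 2); rewrite lte_fin; lra.
    + by exists (r + 1); rewrite ?ltry// lte_fin; lra.
  - by rewrite ltNge leey.
have [V xV aV] := J2lsc _ _ aJ2; have [B xB BV] := X_regular xV.
have oB : open (interior B) by exact: open_interior.
have lo := J1lb _ oB; have hi := J2ub _ (@closed_closure _ B).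
suff : (- J1 x <= - a%:E)%E by rewrite leeN2 leNgt J1a.
have : (- J1 x <= - ereal_inf (J1 @` interior B))%E.
  by rewrite leeN2; apply: ereal_inf_lbound; exists x.
move=> /le_trans; apply; apply: le_trans lo _.
apply: le_trans (limn_einf_sup _) _.
have : (- ereal_inf (J2 @` closure B) <= - a%:E)%E.
  by rewrite leeN2; apply: le_ereal_inf_tmp => _ [y By <-]; exact/ltW/aV/BV.
apply: le_trans; apply: le_trans hi; apply: le_limn_esup => n.
rewrite lee_pmul2l ?lte_fin ?invr_gt0 ?ltr0n//.
have muP (A : set (borel X)) : mu n A \in `[0%E, +oo%E]%R.
  by rewrite in_itv /= measure_ge0 leey.
have mB : measurable (closure B : set (borel X)).
  rewrite -[closure B]setCK; apply: measurableC; apply: sub_sigma_algebra.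
  exact/closed_openC/closed_closure.
rewrite lee_lne ?muP//; apply: le_measure; rewrite ?inE//.
  exact: sub_sigma_algebra.
by apply: (subset_trans (@interior_subset _ B)); exact: subset_closure.
Qed.

Lemma LDP_unique (J1 J2 : X -> \bar R) : LDP mu J1 -> LDP mu J2 -> J1 = J2.
Proof.
by move=> L1 L2; apply/funext => x; apply/eqP; rewrite eq_le !LDP_le.
Qed.

End LDPUnique.

(** * Continuity of the rate on the line *)

Section RateContinuous.
Context (R : realType).

Lemma xlnx_continuous : continuous (@xlnx R).
Proof.
move=> x; have [x0|x0|->] := ltgtP x 0.
(* Since [ln] is 0 at nonpositive reals, [xlnx] vanishes near a negative [x]. *)
- have : \forall y \near x, xlnx y = xlnx x.
    near=> y; rewrite /xlnx !ln0 ?mulr0// ltW//.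
    by near: y; exact: lt_nbhsl.
  exact: cvg_near_cst.
- by apply: cvgM; [exact: cvg_id|exact: continuous_ln].
rewrite /continuous_at {2}/xlnx mul0r.
(* At 0, y ln y is squeezed between -2 sqrt |y| and 0. *)
have sq0 : - (2 * Num.sqrt `|y|) @[y --> (0:R)] --> (0 : R).
  rewrite -[X in _ --> X]oppr0; apply: cvgN; rewrite -[X in _ --> X](mulr0 2).
  apply: cvgM; first exact: cvg_cst.
  rewrite -[X in _ --> X]sqrtr0 -[X in Num.sqrt X](@normr0 _ R).
  apply: continuous_cvg; first exact: sqrt_continuous.
  by apply: cvg_norm; exact: cvg_id.
apply: (squeeze_cvgr _ sq0 (cvg_cst 0)); near=> y.
have y1 : y < 1 by near: y; apply: lt_nbhsl; exact: ltr01.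
have [y0|y0] := leP y 0.
  by rewrite /xlnx ln0// mulr0 lexx andbT oppr_le0 mulr_ge0.
rewrite /xlnx; apply/andP; split; last by apply: mulr_ge0_le0; rewrite ?ln_le0 ?ltW.
rewrite gtr0_norm//.
set s := Num.sqrt y; have s0 : 0 < s by rewrite sqrtr_gt0.
have -> : y = s ^+ 2 by rewrite sqr_sqrtr// ltW.
(* With s = sqrt y, the bound ln (1/s) < 1/s gives -s ln s < 1, hence y ln y = 2 s^2 ln s >= -2
   s. *)
have := ln_sublinear (_ : 0 < s^-1); rewrite invr_gt0 => /(_ s0).
rewrite lnV ?posrE// lnXn// -(ltr_pM2l s0) divff ?gt_eqF// => lt1.
have : 0 <= s * (1 - s * - ln s)
  by apply: mulr_ge0; [exact: ltW|rewrite subr_ge0; exact: ltW].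
by rewrite mulr2n; lra.
Unshelve. all: by end_near. Qed.

Lemma dyck_rate_fun_continuous (M : nat) : continuous (@dyck_rate_fun R M).
Proof.
have onem : continuous (fun t : R => 1 - t).
  by move=> t; apply: cvgB; [exact: cvg_cst|exact: cvg_id].
have maxE (t : R) : Num.max t (1 - t) = 2^-1 * (1 + `|t - (1 - t)|).
  by case: (leP t (1 - t)) => ht; [rewrite ler0_norm|rewrite gtr0_norm]; lra.
move=> t; rewrite /dyck_rate_fun /entropy; apply: cvgB; first apply: cvgB.
- exact: cvg_cst.
- apply: cvgN; apply: cvgD; first exact: xlnx_continuous.
  by apply: continuous_cvg; [exact: xlnx_continuous|exact: onem].
apply: cvgM; last exact: cvg_cst.
rewrite maxE; under eq_fun do rewrite maxE.
apply: cvgM; first exact: cvg_cst.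
apply: cvgD; first exact: cvg_cst.
apply: cvg_norm; apply: cvgB; [exact: cvg_id|exact: onem].
Qed.

End RateContinuous.

(** * Large deviations for the Dyck shift *)

Section DyckLDP.
Context (R : realType) (M : nat) (hM : (2 <= M)%N).
Let M0 : (0 < M)%N := ltnW hM.

Lemma dyck_rate_ge0 (t : R) : (0 <= dyck_rate R M t)%E.
Proof.
rewrite dyck_rateE//; case: ifP => [t01|_]; last exact: leey.
by rewrite lee_fin dyck_rate_fun_ge0.
Qed.

(** The rate is nowhere below the continuous [dyck_rate_fun], with equality on [0, 1]; on the open
    complement it is infinite. *)
Lemma dyck_rate_lsc : lower_semicontinuous (dyck_rate R M).
Proof.
move=> t a; rewrite dyck_rateE//; case: ifPn => [t01|tN01 _].
  rewrite lte_fin => at'; exists [set s | a < dyck_rate_fun M s].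
    exact: (cvgr_gt _ (@dyck_rate_fun_continuous R M t)).
  by move=> s /= as'; rewrite dyck_rateE//; case: ifP => _; rewrite ?lte_fin// ltry.
exists (~` `[0, 1]).
  by apply: open_nbhs_nbhs; split;
    [exact/closed_openC/itv_closed|rewrite /= in_itv /=; exact/negP].
move=> s; rewrite /= in_itv /= => /negP s01.
by rewrite dyck_rateE// (negPf s01) ltry.
Qed.

Let err (m : nat) : R := ln m.+2%:R / m.+1%:R.

Let err_cvg0 : err m @[m --> \oo] --> (0 : R).
Proof.
(* At x = 1/(m+2), -2 x ln x = 2 ln (m+2) / (m+2) dominates [err m], because m + 2 <= 2 (m + 1). *)
have h0 : - (2 * xlnx (m.+2%:R^-1 : R)) @[m --> \oo] --> (0 : R).
  rewrite -[X in _ --> X]oppr0; apply: cvgN; rewrite -[X in _ --> X](mulr0 2).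
  apply: cvgM; first exact: cvg_cst.
  have <- : xlnx 0 = 0 :> R by rewrite /xlnx mul0r.
  apply: continuous_cvg; first exact: xlnx_continuous.
  by have := @cvg_harmonic R; rewrite -cvg_shiftS.
apply: (squeeze_cvgr _ (cvg_cst 0) h0); near=> m; rewrite /err.
have l0 : 0 <= ln (m.+2%:R : R) by rewrite ln_ge0// ler1n.
rewrite /cst divr_ge0//= /xlnx lnV ?posrE ?ltr0n// !mulrN opprK mulrA mulrC.
rewrite ler_wpM2r// ler_pdivlMr ?ltr0n// mulrC ler_pdivrMr ?ltr0n//.
by rewrite -natrM ler_nat; lia.
Unshelve. all: by end_near. Qed.

Let term (m b : nat) : R := (dyck_count M m.+1 b)%:R / (dyck_total M m.+1)%:R.

Let total_gt0 m : (0 < (dyck_total M m.+1)%:R :> R).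
Proof.
have /andP[h _] := dyck_total_bounds M0 m.+1.
by rewrite ltr0n (leq_trans _ h)// expn_gt0.
Qed.

Let term_gt0 m b : (b <= m.+1)%N -> 0 < term m b.
Proof.
move=> bm; rewrite divr_gt0// ltr0n /dyck_count muln_gt0 bin_gt0 bm expn_gt0.
by rewrite M0.
Qed.

Let lawE m B : dyck_law R hM m B =
  (\sum_(b < m.+2 | `[< B (b%:R / m.+1%:R) >]) term m b)%:E.
Proof. by rewrite dyck_lawE natr_sum mulr_suml. Qed.

Let ratio_in01 m b : (b <= m.+1)%N -> 0 <= (b%:R / m.+1%:R : R) <= 1.
Proof.
by move=> bm; rewrite divr_ge0//= ler_pdivrMr ?ltr0n// mul1r ler_nat.
Qed.

(** The mass of [G] is at least that of one atom close to [t], whose exponential rate tends to that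
    of [t] by continuity. *)
Lemma dyck_LDP_lower (G : set R) : open G ->
  (- ereal_inf (dyck_rate R M @` G) <=
   limn_einf (fun n => (n.+1%:R^-1)%:E * lne (dyck_law R hM n G)))%E.
Proof.
move=> oG; rewrite leeNl; apply: le_ereal_inf_tmp => _ [t Gt <-]; rewrite leeNl.
rewrite dyck_rateE//; case: ifP => [/andP[t0 t1]|_]; last by rewrite leNye.
(* [q m] is the largest atom not exceeding [t], hence within 1/(m+1) of it. *)
pose b (m : nat) := Num.truncn (t * m.+1%:R).
pose q (m : nat) : R := (b m)%:R / m.+1%:R.
have bP m : (b m)%:R <= t * m.+1%:R < (b m).+1%:R.
  by apply: truncn_itv; rewrite mulr_ge0.
have bm m : (b m <= m.+1)%N.
  have /andP[h _] := bP m; rewrite -(ler_nat R) (le_trans h)//.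
  by rewrite ler_piMl.
have qt : q m @[m --> \oo] --> t.
  have h : t - harmonic m @[m --> \oo] --> t.
    by rewrite -[X in _ --> X]subr0; apply: cvgB; [exact: cvg_cst|exact: cvg_harmonic].
  apply: (squeeze_cvgr _ h (cvg_cst t)); near=> m.
  have /andP[lo hi] := bP m; rewrite /q /cst ler_pdivrMr ?ltr0n// lo andbT.
  rewrite ler_pdivlMr ?ltr0n// mulrBl /= mulVf ?pnatr_eq0//.
  by move: hi; rewrite -natr1; lra.
(* [2 * err m] covers the losses ln (m+2) and ln 2, divided by m + 1. *)
have rq : (- dyck_rate_fun M (q m) - 2 * err m) @[m --> \oo] --> - dyck_rate_fun M t.
  rewrite -[X in _ --> X]subr0; apply: cvgB.
    by apply: cvgN; apply: continuous_cvg; [exact: dyck_rate_fun_continuous|].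
  by rewrite -[X in _ --> X](mulr0 2); apply: cvgM; [exact: cvg_cst|].
apply/lee_subgt0Pr => e e0; apply: limn_einf_ge; near=> m.
have Gq : G (q m) by near: m; apply: qt; exact: open_nbhs_nbhs.
have : - dyck_rate_fun M t - e < - dyck_rate_fun M (q m) - 2 * err m.
  by near: m; apply: (cvgr_gt _ rq); rewrite ltrBlDr ltrDl.
move=> /ltW le_e; rewrite lawE.
set s := \sum_(_ | _) _.
have ts : term m (b m) <= s.
  rewrite /s (bigD1 (inord (b m))) /= ?inordK ?ltnS//; last exact/asboolP.
  by rewrite lerDl sumr_ge0// => i _; rewrite ltW// term_gt0// -ltnS.
have t0' := term_gt0 (bm m).
rewrite lne_EFin ?(lt_le_trans t0')// -EFinN -EFinD -EFinM lee_fin.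
apply: le_trans le_e _; rewrite [leRHS]mulrC ler_pdivlMr ?ltr0n//.
have : ln (term m (b m)) <= ln s by rewrite ler_ln ?posrE ?(lt_le_trans t0').
apply: le_trans.
have /andP[+ _] := dyck_count_bounds R M0 (ltn0Sn m) (bm m).
apply: le_trans; rewrite -/(q m) mulrBl mulNr [_ * dyck_rate_fun _ _]mulrC.
rewrite -!addrA lerD2l -opprD lerN2 /err -mulrA divfK ?pnatr_eq0//.
have : ln (2 : R) <= ln m.+2%:R by rewrite ler_ln ?posrE ?ltr0n// ler_nat.
by lra.
Unshelve. all: by end_near. Qed.

(** At most m + 2 atoms lie in [C], each of mass at most exp (-(m+1) I); their number costs only
    [err m]. *)
Lemma dyck_LDP_upper (C : set R) :
  (limn_esup (fun n => (n.+1%:R^-1)%:E * lne (dyck_law R hM n C)) <=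
   - ereal_inf (dyck_rate R M @` C))%E.
Proof.
set I := ereal_inf _; apply/lee_addgt0Pr => e e0.
have I0 : (0 <= I)%E.
  by apply: le_ereal_inf_tmp => _ [t _ <-]; exact: dyck_rate_ge0.
apply: limn_esup_le; near=> m; rewrite lawE.
have erre : err m < e by near: m; exact: (cvgr_lt _ err_cvg0).
have [/existsP[b0 /asboolP Cb0]|/existsPn nC] :=
    boolP [exists b : 'I_m.+2, `[< C (b%:R / m.+1%:R) >]]; last first.
  rewrite big1; last by move=> b Cb; move: (nC b); rewrite Cb.
  by rewrite le0_lneNy// mulrNy gtr0_sg ?invr_gt0 ?ltr0n// mul1e leNye.
have leI (b : 'I_m.+2) : C (b%:R / m.+1%:R) ->
    (I <= (dyck_rate_fun M (b%:R / m.+1%:R))%:E)%E.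
  move=> Cb; apply: ge_ereal_inf; exists (dyck_rate R M (b%:R / m.+1%:R)).
    by exists (b%:R / m.+1%:R).
  by rewrite dyck_rateE// ratio_in01// -ltnS.
(* An atom in [C] lies in [0, 1], where the rate is finite, so [I] is real. *)
have [i Ii] : exists i, I = i%:E.
  by move: (leI _ Cb0) I0; move: {leI} I => [i _ _||]//; exists i.
rewrite Ii; set s := \sum_(_ | _) _.
have s0 : 0 < s.
  rewrite /s (bigD1 b0) /=; last exact/asboolP.
  rewrite ltr_pwDl ?term_gt0 -1?ltnS// sumr_ge0// => b _.
  by rewrite ltW// term_gt0// -ltnS.
have sle : s <= m.+2%:R * expR (- (m.+1%:R * i)).
  apply: (@le_trans _ _ (\sum_(b < m.+2) expR (- (m.+1%:R * i)))); last first.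
    by rewrite sumr_const card_ord [leRHS]mulr_natl.
  rewrite /s big_mkcond /=; apply: ler_sum => b _; case: asboolP => Cb; last first.
    exact: expR_ge0.
  have bm : (b <= m.+1)%N by rewrite -ltnS.
  rewrite -[X in X <= _]lnK ?posrE ?term_gt0// ler_expR.
  have /andP[_ /le_trans] := dyck_count_bounds R M0 (ltn0Sn m) bm; apply.
  by rewrite lerN2 ler_wpM2l// -lee_fin -Ii leI.
rewrite lne_EFin// -EFinN -EFinD -EFinM lee_fin [leLHS]mulrC ler_pdivrMr ?ltr0n//.
move: sle; rewrite -ler_ln ?posrE ?mulr_gt0 ?expR_gt0 ?ltr0n//.
rewrite lnM ?posrE ?expR_gt0 ?ltr0n// expRK => /le_trans; apply.
rewrite addrC mulrDl mulNr mulrC lerD2l.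
by move: erre; rewrite /err ltr_pdivrMr ?ltr0n// => /ltW.
Unshelve. all: by end_near. Qed.

Lemma dyck_LDP : LDP (dyck_law R hM) (dyck_rate R M).
Proof.
split; [exact: dyck_rate_ge0|exact: dyck_rate_lsc|exact: dyck_LDP_lower|].
by move=> C _; exact: dyck_LDP_upper.
Qed.

(** * Failure of convexity and of differentiability *)

Lemma dyck_rate_fun_sym (t : R) : dyck_rate_fun M (1 - t) = dyck_rate_fun M t.
Proof.
by rewrite /dyck_rate_fun /entropy subKr maxC [xlnx (1 - t) + _]addrC.
Qed.

Let M_gt0 : (0 < M%:R :> R). Proof. by rewrite ltr0n. Qed.
Let M1_gt0 : (0 < M.+1%:R :> R). Proof. by rewrite ltr0n. Qed.

Lemma dyck_rate_fun_zero : dyck_rate_fun M (M%:R / M.+1%:R) = 0 :> R.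
Proof.
have M10 : M.+1%:R != 0 :> R by rewrite gt_eqF.
have e : 1 - M%:R / M.+1%:R = M.+1%:R^-1 :> R.
  by apply: (mulIf M10); rewrite mulrBl mulVf// divfK// -natr1; ring.
rewrite /dyck_rate_fun /entropy e max_l; last first.
  by rewrite ler_pdivlMr// mulVf// ler1n.
rewrite /xlnx ln_div ?posrE// lnV ?posrE//.
by move: e; set p := _ / _ => <-; ring.
Qed.

(** The value is half of ln ((M+1)^2 / (4M)), positive because (M-1)^2 > 0. *)
Lemma dyck_rate_fun_half_gt0 : 0 < dyck_rate_fun M (2^-1) :> R.
Proof.
have e : 1 - 2^-1 = 2^-1 :> R by lra.
rewrite /dyck_rate_fun /entropy e maxxx /xlnx lnV ?posrE//.
have : ln (4 * M%:R : R) < ln (M.+1%:R ^+ 2).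
  rewrite ltr_ln ?posrE ?mulr_gt0 ?exprn_gt0// -natr1.
  have : (2 <= M%:R :> R) by rewrite ler_nat.
  by nra.
have -> : (4 : R) = 2 ^+ 2 by rewrite -natrX.
rewrite lnM ?posrE ?exprn_gt0// !lnXn//; lra.
Qed.

(** The rate vanishes at M/(M+1) and, by symmetry, at 1/(M+1), but is positive at their midpoint
    1/2. *)
Lemma dyck_rate_not_convex : ~ ereal_convex (dyck_rate R M).
Proof.
set t : R := M%:R / M.+1%:R.
have t0 : dyck_rate_fun M t = 0 by exact: dyck_rate_fun_zero.
have t01 : 0 <= t <= 1.
  by rewrite divr_ge0//= ler_pdivrMr// mul1r ler_nat leqnSn.
move=> /(_ t (1 - t) (2^-1)) /(_ ltac:(lra)).
have -> : 2^-1 * t + (1 - 2^-1) * (1 - t) = 2^-1 :> R by lra.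
rewrite !dyck_rateE// t01 (_ : 0 <= 1 - t <= 1); last by lra.
rewrite (_ : 0 <= (2^-1 : R) <= 1); last by lra.
by rewrite dyck_rate_fun_sym t0 !mule0 adde0 lee_fin leNgt dyck_rate_fun_half_gt0.
Qed.

(** By symmetry the difference quotients at h and -h are opposite, so a derivative would make both
    small; yet the term -max(t, 1-t) ln M keeps the right one close to -ln M. *)
Lemma dyck_rate_not_differentiable :
  ~ differentiable (fun t : R => fine (dyck_rate R M t)) (2^-1 : R).
Proof.
move=> /derivable1_diffP; set f := fun t => _; pose L : R := ln M%:R.
have L0 : 0 < L by rewrite ln_gt0// ltr1n.
have fE (t : R) : 0 <= t <= 1 -> f t = dyck_rate_fun M t.
  by move=> t01; rewrite /f dyck_rateE// t01.
have f_sym (h : R) : 0 <= h <= 4^-1 -> f (2^-1 - h) = f (2^-1 + h).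
  move=> h4; rewrite !fE; [|lra|lra].
  have -> : 2^-1 - h = 1 - (2^-1 + h) by lra.
  exact: dyck_rate_fun_sym.
(* The bound ln (1 + x) <= x at x = 2h and x = -2h limits the loss of entropy to 4h^2; the maximum
   contributes -hL. *)
have f_le (h : R) : 0 < h <= 4^-1 -> f (2^-1 + h) - f 2^-1 <= 4 * h ^+ 2 - h * L.
  move=> h4; rewrite !fE; [|lra|lra].
  rewrite /dyck_rate_fun /entropy -/L.
  have -> : 1 - (2^-1 + h) = 2^-1 - h by lra.
  have -> : 1 - 2^-1 = 2^-1 :> R by lra.
  rewrite maxxx max_l; last by lra.
  have lnD (x : R) : -1 < x -> ln (2^-1 * (1 + x)) <= - ln 2 + x.
    move=> x1; rewrite lnM ?posrE ?invr_gt0//; last by lra.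
    by rewrite lnV ?posrE// lerD2l le_ln1Dx.
  have l1 := lnD (2 * h) ltac:(lra); have l2 := lnD (- (2 * h)) ltac:(lra).
  have e1 : 2^-1 * (1 + 2 * h) = 2^-1 + h by field.
  have e2 : 2^-1 * (1 - 2 * h) = 2^-1 - h by field.
  rewrite e1 in l1; rewrite e2 in l2.
  rewrite /xlnx lnV ?posrE//.
  have p1 : 0 <= (2^-1 + h) * (- ln 2 + 2 * h - ln (2^-1 + h)).
    by apply: mulr_ge0; lra.
  have p2 : 0 <= (2^-1 - h) * (- ln 2 - 2 * h - ln (2^-1 - h)).
    by apply: mulr_ge0; lra.
  rewrite -subr_ge0; apply: le_trans (addr_ge0 p1 p2) _.
  by rewrite -subr_ge0 le_eqVlt; apply/orP; left; apply/eqP; field.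
rewrite /derivable => /cvg_ex[/= d].
move=> /cvgrPdist_le /(_ (L / 4)) /(_ ltac:(lra)); rewrite near_withinE.
move=> /nbhs_ballP[r /= r0 rP].
(* [r / 2] keeps h and -h in the ball, 1/4 allows [f_sym] and [f_le], and [L / 16] makes the right
   quotient at most -3L/4. Opposite quotients within L/4 of [d] are at most L/4 in absolute
   value. *)
pose h := Num.min (r / 2) (Num.min (L / 16) 4^-1).
have h0 : 0 < h by rewrite !lt_min !divr_gt0//= invr_gt0.
have hr : h <= r / 2 by rewrite ge_min lexx.
have hL : h <= L / 16 by rewrite !ge_min lexx ?orbT.
have h4 : h <= 4^-1 by rewrite !ge_min lexx ?orbT.
have rball (x : R) : `|x| <= r / 2 -> `|0 - x| < r.
  by move=> xr; rewrite sub0r normrN; lra.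
have := rP h; have := rP (- h).
move=> /(_ (rball _ _)); rewrite normrN gtr0_norm// => /(_ hr).
rewrite oppr_eq0 gt_eqF// => /(_ isT) qN.
move=> /(_ (rball _ _)); rewrite gtr0_norm// => /(_ hr).
move=> /(_ isT); move: qN.
rewrite /= ![_%:A]mulr1 ![_ + 2^-1]addrC f_sym; last by lra.
set D := f _ - f _; rewrite /GRing.scale /= invrN mulNr => qN qP.
have hD : h^-1 * D <= 4 * h - L.
  rewrite mulrC ler_pdivrMr// (le_trans (f_le h _))//; first lra.
  by rewrite mulrBl -mulrA -expr2 [L * h]mulrC.
by move: qN qP; rewrite !ler_norml; lra.
Qed.

End DyckLDP.

Theorem mainTheorem5 (R : realType) (M : nat) (hM : (2 <= M)%N) :
  (forall J : R -> \bar R, LDP (dyck_law R hM) J <-> J = dyck_rate R M) /\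
  ~ ereal_convex (dyck_rate R M) /\
  ~ differentiable (fun t : R => fine (dyck_rate R M t)) (2^-1 : R).
Proof.
split=> [J|].
  split=> [LJ|->]; last exact: dyck_LDP.
  exact: (LDP_unique (@uniform_regular R) LJ (dyck_LDP R hM)).
by split; [exact: dyck_rate_not_convex|exact: dyck_rate_not_differentiable].
Qed.
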